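(* Let $k$ be a field and $n\ge 3$. Then $\mathrm{Aut}(Q_n)=k^*\times S_n$, where $\tau\in S_n$ acts by $v_A\mapsto v_{\tau(A)}$ and $\alpha\in k^*$ acts by $v_A\mapsto \alpha v_A$ on generators.
   Context: $Q_n$ is the associative unital $k$-algebra generated by $v_A$ for nonempty $A\subseteq\{1,\dots,n\}$ (with the convention $v_\emptyset:=0$), with relations $$v_A(v_{A\setminus i}-v_{A\setminus j})-v_{A\setminus i}^2+v_{A\setminus j}^2+(v_{A\setminus i}-v_{A\setminus j})v_{A\setminus\{i,j\}}=0$$ for all $A\subseteq\{1,\dots,n\}$ with $|A|\ge 2$ and distinct $i,j\in A$. It is the algebra associated with the layered graph of the lattice of subsets of $\{1,\dots,n\}$. $Q_n$ is graded by word length in the generators, $Q_n=\bigoplus_i (Q_n)_{[i]}$. It also carries an increasing filtration: giving $v_A$ the weight $|A|$, $(Q_n)_{(i)}$ is the span of products of generators of total weight at most $i$. $\mathrm{Aut}(Q_n)$ denotes the group of automorphisms of the graded algebra $Q_n$ (algebra automorphisms preserving each $(Q_n)_{[i]}$) that preserve the filtration (mapping each $(Q_n)_{(i)}$ onto itself). *)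

(* Defs.v *)
From HB Require Import structures.
From mathcomp Require Import all_boot all_order all_fingroup all_algebra.
From mathcomp Require Import generic_quotient ring_quotient.
From mathcomp Require Import boolp classical_sets.
From mathcomp Require Import monalg.

Set Implicit Arguments.
Unset Strict Implicit.
Unset Printing Implicit Defensive.

Import GRing.Theory.
Local Open Scope ring_scope.

(* The free associative unital algebra on X: the monoid algebra of the free   *)
(* monoid on X.                                                               *)
Definition freealg (k : comNzRingType) (X : choiceType) := {malg k[{fmonom X}]}.

Section FreeAlg.
Variables (k : comNzRingType) (X : choiceType).

HB.instance Definition _ := GRing.Lalgebra.on (freealg k X).

Lemma freealg_scalerAr (c : k) (x y : freealg k X) : c *: (x * y) = x * (c *: y).
Proof.
have cC z : z * (c%:MP : freealg k X) = c%:MP * z.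
  rewrite (monalgE z) mulr_suml mulr_sumr; apply: eq_bigr => m _.
  by rewrite !malgM_def !fgmulUU mul1m mulm1 mulrC.
by rewrite -!mul_malgC mulrA -cC -mulrA.
Qed.

HB.instance Definition _ :=
  GRing.Lalgebra_isAlgebra.Build k (freealg k X) freealg_scalerAr.

Definition freeaug : freealg k X -> k := mcoeff mone.

Lemma freeaug_zmod : zmod_morphism freeaug.
Proof. exact: (raddfB (mcoeff mone : {additive {malg k[{fmonom X}]} -> k})). Qed.

Lemma freeaug_mul : monoid_morphism freeaug.
Proof.
split; first exact: (rmorph1 (mcoeff mone : {rmorphism {malg k[{fmonom X}]} -> k})).
exact: (rmorphM (mcoeff mone : {rmorphism {malg k[{fmonom X}]} -> k})).
Qed.

HB.instance Definition _ :=
  GRing.isZmodMorphism.Build (freealg k X) k freeaug freeaug_zmod.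
HB.instance Definition _ :=
  GRing.isMonoidMorphism.Build (freealg k X) k freeaug freeaug_mul.

Definition freegen (x : X) : freealg k X := << fmu x >>.
End FreeAlg.

(* Two-sided: elements are finite sums of a * r * b with r in S. *)
Definition ideal_gen (R : nzRingType) (S : set R) : set R :=
  [set x | exists s : seq (R * R * R),
     (forall t, t \in s -> S t.1.2) /\ x = \sum_(t <- s) t.1.1 * t.1.2 * t.2].

Section IdealGen.
Variables (R : nzRingType) (S : set R).

Lemma ideal_gen0 : ideal_gen S 0.
Proof. by exists [::]; split=> //; rewrite big_nil. Qed.

Lemma ideal_genD x y : ideal_gen S x -> ideal_gen S y -> ideal_gen S (x + y).
Proof.
move=> [s [Ss ->]] [t [St ->]]; exists (s ++ t); split; last by rewrite big_cat.
by move=> u; rewrite mem_cat => /orP[/Ss|/St].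
Qed.

Lemma ideal_genMl a x : ideal_gen S x -> ideal_gen S (a * x).
Proof.
move=> [s [Ss ->]]; exists [seq ((a * t.1.1, t.1.2), t.2) | t <- s]; split.
  by move=> u /mapP[t /Ss St ->].
by rewrite big_map mulr_sumr; apply: eq_bigr => t _; rewrite /= !mulrA.
Qed.

Lemma ideal_genMr a x : ideal_gen S x -> ideal_gen S (x * a).
Proof.
move=> [s [Ss ->]]; exists [seq ((t.1.1, t.1.2), t.2 * a) | t <- s]; split.
  by move=> u /mapP[t /Ss St ->].
by rewrite big_map mulr_suml; apply: eq_bigr => t _; rewrite /= !mulrA.
Qed.

Lemma ideal_genB x y : ideal_gen S x -> ideal_gen S y -> ideal_gen S (x - y).
Proof. by move=> Ix Iy; rewrite -mulN1r; apply/ideal_genD/ideal_genMl. Qed.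

Lemma sub_ideal_gen x : S x -> ideal_gen S x.
Proof.
move=> Sx; exists [:: ((1, x), 1)]; split.
  by move=> t; rewrite inE => /eqP ->.
by rewrite big_seq1 mul1r mulr1.
Qed.

End IdealGen.

Section Qn.
Variables (k : fieldType) (n : nat).

Definition Qgen := {A : {set 'I_n} | A != finset.set0}.
HB.instance Definition _ := Finite.on Qgen.

(* v_A in the free algebra, with the convention v_set0 = 0. *)
Definition Qvar (A : {set 'I_n}) : freealg k Qgen :=
  if insub A is Some g then freegen k g else 0.

Definition Qrel (A : {set 'I_n}) (i j : 'I_n) : freealg k Qgen :=
  Qvar A * (Qvar (A :\ i) - Qvar (A :\ j))
  - Qvar (A :\ i) ^+ 2 + Qvar (A :\ j) ^+ 2
  + (Qvar (A :\ i) - Qvar (A :\ j)) * Qvar (A :\ i :\ j).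

Definition Qrels : set (freealg k Qgen) :=
  [set r | exists (A : {set 'I_n}) (i j : 'I_n),
     [/\ (2 <= #|A|)%N, i \in A, j \in A, i != j & r = Qrel A i j]].

Lemma freeaug_Qvar A : freeaug (Qvar A) = 0.
Proof.
rewrite /Qvar; case: insub => [g|]; last by rewrite rmorph0.
rewrite /freeaug /freegen mcoeffU1; case: eqP => // /(congr1 (@fdeg _)).
by rewrite fdegU fdeg1.
Qed.

Lemma Qrels_proper : ~ ideal_gen Qrels 1.
Proof.
move=> [s [Ss /(congr1 (@freeaug _ _))]]; rewrite rmorph1 rmorph_sum big_seq big1.
  by move/eqP; rewrite oner_eq0.
move=> t /Ss [A [i [j [_ _ _ _ tE]]]]; rewrite !rmorphM /= tE /Qrel.
rewrite !(rmorphD, rmorphN, rmorphB, rmorphM, rmorphXn) /= !freeaug_Qvar.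
by rewrite !(subr0, mul0r, mulr0, expr0n, addr0, oppr0).
Qed.

Definition Qideal : {pred freealg k Qgen} := fun x => `[< ideal_gen Qrels x >].

Lemma QidealP x : reflect (ideal_gen Qrels x) (x \in Qideal).
Proof. exact: asboolP. Qed.

Lemma Qideal_zmod_closed : zmod_closed Qideal.
Proof.
split; first exact/QidealP/ideal_gen0.
by move=> x y /QidealP Ix /QidealP Iy; apply/QidealP/ideal_genB.
Qed.

HB.instance Definition _ :=
  GRing.isZmodClosed.Build (freealg k Qgen) Qideal Qideal_zmod_closed.

Definition Qalg := Quotient.quot Qideal.

HB.instance Definition _ := GRing.Zmodule.on Qalg.

Definition Qpi (x : freealg k Qgen) : Qalg := (\pi_Qalg x)%qT.

Lemma Qpi_eq x y : (Qpi x == Qpi y) = (x - y \in Qideal).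
Proof. by rewrite Quotient.idealrBE. Qed.

Lemma QpiP x y : Qpi x = Qpi y <-> ideal_gen Qrels (x - y).
Proof. by split=> [/eqP|/QidealP Ixy]; [|apply/eqP]; rewrite Qpi_eq // => /QidealP. Qed.

Lemma Qpi_surj (u : Qalg) : exists x, u = Qpi x.
Proof. by exists (repr u); rewrite /Qpi reprK. Qed.

Lemma Qpi_repr x : ideal_gen Qrels (repr (Qpi x) - x).
Proof. by apply/QpiP; rewrite /Qpi reprK. Qed.

Definition Qone : Qalg := Qpi 1.
Definition Qmul (u v : Qalg) : Qalg := Qpi (repr u * repr v).
Definition Qscale (c : k) (u : Qalg) : Qalg := Qpi (c *: repr u).

Lemma QpiD x y : Qpi (x + y) = Qpi x + Qpi y.
Proof. by rewrite /Qpi Quotient.pi_add. Qed.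

Lemma QpiM x y : Qpi (x * y) = Qmul (Qpi x) (Qpi y).
Proof.
apply/esym/QpiP; set x' := repr _; set y' := repr _.
have -> : x' * y' - x * y = (x' - x) * y' + x * (y' - y).
  by rewrite mulrBl mulrBr addrA subrK.
by apply: ideal_genD; [apply: ideal_genMr|apply: ideal_genMl]; apply: Qpi_repr.
Qed.

Lemma QpiZ c x : Qpi (c *: x) = Qscale c (Qpi x).
Proof.
apply/esym/QpiP; rewrite -scalerBr -mulr_algl.
exact/ideal_genMl/Qpi_repr.
Qed.

Lemma QmulA : associative Qmul.
Proof.
move=> u v w; have [x ->] := Qpi_surj u; have [y ->] := Qpi_surj v.
by have [z ->] := Qpi_surj w; rewrite -!QpiM mulrA.
Qed.

Lemma Qmul1 : left_id Qone Qmul.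
Proof. by move=> u; have [x ->] := Qpi_surj u; rewrite -QpiM mul1r. Qed.

Lemma Q1mul : right_id Qone Qmul.
Proof. by move=> u; have [x ->] := Qpi_surj u; rewrite -QpiM mulr1. Qed.

Lemma QmulDl : left_distributive Qmul +%R.
Proof.
move=> u v w; have [x ->] := Qpi_surj u; have [y ->] := Qpi_surj v.
by have [z ->] := Qpi_surj w; rewrite -QpiD -!QpiM mulrDl QpiD.
Qed.

Lemma QmulDr : right_distributive Qmul +%R.
Proof.
move=> u v w; have [x ->] := Qpi_surj u; have [y ->] := Qpi_surj v.
by have [z ->] := Qpi_surj w; rewrite -QpiD -!QpiM mulrDr QpiD.
Qed.

Lemma Qone_neq0 : Qone != 0.
Proof.
have <- : Qpi 0 = 0 by apply: (addrI (Qpi 0)); rewrite addr0 -QpiD addr0.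
by rewrite Qpi_eq subr0; apply/negP => /QidealP/Qrels_proper.
Qed.

HB.instance Definition _ :=
  GRing.Zmodule_isNzRing.Build Qalg QmulA Qmul1 Q1mul QmulDl QmulDr Qone_neq0.

Lemma QscaleA a b u : Qscale a (Qscale b u) = Qscale (a * b) u.
Proof. by have [x ->] := Qpi_surj u; rewrite -!QpiZ scalerA. Qed.

Lemma Qscale1 : left_id 1 Qscale.
Proof. by move=> u; have [x ->] := Qpi_surj u; rewrite -QpiZ scale1r. Qed.

Lemma QscaleDr : right_distributive Qscale +%R.
Proof.
move=> c u v; have [x ->] := Qpi_surj u; have [y ->] := Qpi_surj v.
by rewrite -QpiD -!QpiZ scalerDr QpiD.
Qed.

Lemma QscaleDl u : {morph Qscale^~ u : a b / a + b}.
Proof.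
by move=> a b; have [x ->] := Qpi_surj u; rewrite -!QpiZ scalerDl QpiD.
Qed.

HB.instance Definition _ :=
  GRing.Zmodule_isLmodule.Build k Qalg QscaleA Qscale1 QscaleDr QscaleDl.

Lemma QscaleAl (c : k) (u v : Qalg) : c *: (u * v) = (c *: u) * v.
Proof.
have [x ->] := Qpi_surj u; have [y ->] := Qpi_surj v.
by rewrite -[_ * _]QpiM -[c *: _ in RHS]QpiZ -[RHS]QpiM -[LHS]QpiZ scalerAl.
Qed.

HB.instance Definition _ := GRing.Lmodule_isLalgebra.Build k Qalg QscaleAl.

Lemma QscaleAr (c : k) (u v : Qalg) : c *: (u * v) = u * (c *: v).
Proof.
have [x ->] := Qpi_surj u; have [y ->] := Qpi_surj v.
by rewrite -[_ * _]QpiM -[c *: _ in RHS]QpiZ -[RHS]QpiM -[LHS]QpiZ scalerAr.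
Qed.

HB.instance Definition _ := GRing.Lalgebra_isAlgebra.Build k Qalg QscaleAr.

Lemma Qpi_zmod_morphism : zmod_morphism Qpi.
Proof. by move=> x y; apply/eqP; rewrite eq_sym subr_eq -QpiD subrK. Qed.

Lemma Qpi_monoid_morphism : monoid_morphism Qpi.
Proof. by split; [|exact: QpiM]. Qed.

Lemma Qpi_scalable : scalable Qpi.
Proof. exact: QpiZ. Qed.

HB.instance Definition _ :=
  GRing.isZmodMorphism.Build (freealg k Qgen) Qalg Qpi Qpi_zmod_morphism.
HB.instance Definition _ :=
  GRing.isMonoidMorphism.Build (freealg k Qgen) Qalg Qpi Qpi_monoid_morphism.
HB.instance Definition _ :=
  GRing.isScalable.Build k (freealg k Qgen) Qalg *:%R Qpi Qpi_scalable.

Definition vgen (A : {set 'I_n}) : Qalg := Qpi (Qvar A).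

Definition vword (w : seq Qgen) : Qalg := \prod_(g <- w) vgen (val g).

Definition vspan (P : seq Qgen -> Prop) : set Qalg :=
  [set x | exists s : seq (k * seq Qgen),
     (forall t, t \in s -> P t.2) /\ x = \sum_(t <- s) t.1 *: vword t.2].

Definition Qgrade (d : nat) : set Qalg := vspan (fun w => size w = d).

Definition Qfilt (d : nat) : set Qalg :=
  vspan (fun w => (\sum_(g <- w) #|val g| <= d)%N).

Definition is_Qaut (f : Qalg -> Qalg) : Prop :=
  [/\ linear f, monoid_morphism f, bijective f,
      forall d, f @` Qgrade d = Qgrade d &
      forall d, f @` Qfilt d = Qfilt d]%classic.

Record Qaut := MkQaut { Qaut_fun :> Qalg -> Qalg; Qaut_prop : is_Qaut Qaut_fun }.

HB.instance Definition _ := gen_eqMixin Qaut.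
HB.instance Definition _ := gen_choiceMixin Qaut.

Lemma Qaut_ext (f g : Qaut) : f =1 g -> f = g.
Proof.
case: f g => [f Hf] [g Hg] /= /funext fg; case: g / fg in Hg *.
by congr MkQaut; apply: Prop_irrelevance.
Qed.

Lemma is_Qaut_id : is_Qaut id.
Proof. by split=> [||| d|d] //; [exists id|rewrite image_id|rewrite image_id]. Qed.

Lemma is_Qaut_comp f g : is_Qaut f -> is_Qaut g -> is_Qaut (g \o f).
Proof.
move=> [fL [f1 fM] fB fG fF] [gL [g1 gM] gB gG gF]; split.
- by move=> c x y /=; rewrite fL gL.
- by split=> [|x y] /=; rewrite ?f1 ?fM.
- exact: bij_comp.
- by move=> d; rewrite -image_comp fG gG.
- by move=> d; rewrite -image_comp fF gF.
Qed.

Lemma is_Qaut_inv f : is_Qaut f -> exists g, [/\ cancel f g, cancel g f & is_Qaut g].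
Proof.
move=> [fL [f1 fM] [g fK gK] fG fF]; exists g; split=> //; split.
- by move=> c x y; apply: (can_inj fK); rewrite fL !gK.
- by split=> [|x y]; apply: (can_inj fK); rewrite ?fM !gK.
- by exists f.
- move=> d; rewrite -[X in (g @` X)%classic]fG image_comp.
  by rewrite (_ : g \o f = id) ?image_id //; apply/funext/fK.
- move=> d; rewrite -[X in (g @` X)%classic]fF image_comp.
  by rewrite (_ : g \o f = id) ?image_id //; apply/funext/fK.
Qed.

Definition Qaut_one : Qaut := MkQaut is_Qaut_id.

(* Left-to-right composition, as for {perm T} where (s * t) x = t (s x). *)
Definition Qaut_mul (f g : Qaut) : Qaut :=
  MkQaut (is_Qaut_comp (Qaut_prop f) (Qaut_prop g)).

Lemma Qaut_has_inv (f : Qaut) : exists g : Qaut, cancel f g /\ cancel g f.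
Proof. by have [g [fK gK Hg]] := is_Qaut_inv (Qaut_prop f); exists (MkQaut Hg). Qed.

Definition Qaut_inv (f : Qaut) : Qaut := projT1 (cid (Qaut_has_inv f)).

Lemma Qaut_mulA : associative Qaut_mul.
Proof. by move=> f g h; apply: Qaut_ext. Qed.

Lemma Qaut_mul1 : left_id Qaut_one Qaut_mul.
Proof. by move=> f; apply: Qaut_ext. Qed.

Lemma Qaut_1mul : right_id Qaut_one Qaut_mul.
Proof. by move=> f; apply: Qaut_ext. Qed.

Lemma Qaut_mulV : left_inverse Qaut_one Qaut_inv Qaut_mul.
Proof.
move=> f; apply: Qaut_ext; rewrite /Qaut_inv; case: cid => g [fK gK] /=.
exact: gK.
Qed.

Lemma Qaut_Vmul : right_inverse Qaut_one Qaut_inv Qaut_mul.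
Proof.
move=> f; apply: Qaut_ext; rewrite /Qaut_inv; case: cid => g [fK gK] /=.
exact: fK.
Qed.

HB.instance Definition _ :=
  isGroup.Build Qaut Qaut_mulA Qaut_mul1 Qaut_1mul Qaut_mulV Qaut_Vmul.

End Qn.

Section Units.
Variable k : fieldType.

Definition kstar := {x : k | x != 0}.
HB.instance Definition _ := Choice.on kstar.

Definition kstar_one : kstar := exist _ 1 (oner_neq0 k).
Definition kstar_mul (a b : kstar) : kstar :=
  exist _ (val a * val b) (mulf_neq0 (valP a) (valP b)).
Definition kstar_inv (a : kstar) : kstar :=
  exist _ (val a)^-1 (invr_neq0 (valP a)).

Lemma kstar_mulA : associative kstar_mul.
Proof. by move=> a b c; apply: val_inj; rewrite /= mulrA. Qed.
Lemma kstar_mul1 : left_id kstar_one kstar_mul.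
Proof. by move=> a; apply: val_inj; rewrite /= mul1r. Qed.
Lemma kstar_1mul : right_id kstar_one kstar_mul.
Proof. by move=> a; apply: val_inj; rewrite /= mulr1. Qed.
Lemma kstar_mulV : left_inverse kstar_one kstar_inv kstar_mul.
Proof. by move=> a; apply: val_inj; rewrite /= mulVf ?(valP a). Qed.
Lemma kstar_Vmul : right_inverse kstar_one kstar_inv kstar_mul.
Proof. by move=> a; apply: val_inj; rewrite /= mulfV ?(valP a). Qed.

HB.instance Definition _ :=
  isGroup.Build kstar kstar_mulA kstar_mul1 kstar_1mul kstar_mulV kstar_Vmul.
End Units.

(* Main.v *)
Require Import Defs.
From HB Require Import structures.
From mathcomp Require Import boolp classical_sets monalg.
From mathcomp Require Import generic_quotient.
From mathcomp Require Import all_boot all_order all_fingroup all_algebra ring.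
Import GRing.Theory.
Local Open Scope ring_scope.

(* Let F(A, B) be the coefficient of v_B in f(v_A); by the filtration it vanishes for
   |B| > |A|.  The map f sends quadratic relations to quadratic relations, which is
   tested on representations v_A |-> p(A) E_01 + q(A) E_12 by strictly upper
   triangular 3 x 3 matrices: composing such a representation with f gives another
   one, for the pair (F p, F q).
   The leading part of the relation of A, i, j is v_A (v_(A - i) - v_(A - j)).  For
   |A| >= 2 this forces the leading part of f(v_A) to be a multiple of a single v_X.
   On coatoms X is given by a permutation s, and by descending induction X = s(A)
   whenever |A| >= 2.  After composing with the inverse of s, the lower order terms
   of the relations show, by ascending induction on |A|, that f(v_A) = c v_A with c
   independent of A. *)

Set Implicit Arguments.
Unset Strict Implicit.
Unset Printing Implicit Defensive.

(** * The universal property of the free algebra *)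

Section FreeLift.
Variables (k : comNzRingType) (X : choiceType) (S : algType k) (h : X -> S).

Definition fmonom_eval (m : {fmonom X}) : S := \prod_(x <- (m : seq X)) h x.

Lemma fmonom_eval_mmorphism : mmorphism fmonom_eval.
Proof.
split=> [m1 m2|]; rewrite /fmonom_eval.
  by rewrite fmM big_cat.
by rewrite fm1 big_nil.
Qed.

HB.instance Definition _ :=
  monalg.isMultiplicative.Build {fmonom X} S fmonom_eval fmonom_eval_mmorphism.

Definition freealg_lift (x : freealg k X) : S :=
  mmap (in_alg S : {rmorphism k -> S}) fmonom_eval x.

Lemma freealg_lift_zmod : zmod_morphism freealg_lift.
Proof. exact: mmap_is_additive. Qed.

Lemma freealg_lift_monoid : monoid_morphism freealg_lift.
Proof.
have [|hM h1] := @commr_mmap_is_multiplicative _ _ _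
    (in_alg S : {rmorphism k -> S}) (fmonom_eval : {mmorphism _ -> _}).
  (* Scalars are central in [S], which is what multiplicativity of [mmap] requires. *)
  by move=> g m m'; rewrite /GRing.comm /= mulr_algl mulr_algr.
by split.
Qed.

Lemma freealg_lift_scalable : scalable freealg_lift.
Proof. by move=> c x; rewrite /freealg_lift mmapZ mulr_algl. Qed.

HB.instance Definition _ :=
  GRing.isZmodMorphism.Build (freealg k X) S freealg_lift freealg_lift_zmod.
HB.instance Definition _ :=
  GRing.isMonoidMorphism.Build (freealg k X) S freealg_lift freealg_lift_monoid.
HB.instance Definition _ :=
  GRing.isScalable.Build k (freealg k X) S *:%R freealg_lift
    freealg_lift_scalable.

Lemma freealg_liftE x : freealg_lift (freegen k x) = h x.
Proof. by rewrite /freealg_lift mmapU /= scale1r mul1r /fmonom_eval fmU big_seq1. Qed.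
End FreeLift.

(** * The universal property of $Q_n$ *)

Lemma vgen0 (k : fieldType) n : vgen k (set0 : {set 'I_n}) = 0.
Proof. by rewrite /vgen /Qvar insubF ?eqxx ?rmorph0. Qed.

Section QLift.
Variables (k : fieldType) (n : nat).
Implicit Types (A B : {set 'I_n}) (i j : 'I_n).

(** Stated over any ring, so that one expression travels along ring morphisms from the free algebra
    to [Qalg] and on to matrices. *)
Definition Qrel_at (S : nzRingType) (h : {set 'I_n} -> S) A i j : S :=
  h A * (h (A :\ i) - h (A :\ j)) - h (A :\ i) ^+ 2 + h (A :\ j) ^+ 2
  + (h (A :\ i) - h (A :\ j)) * h (A :\ i :\ j).

Lemma Qrel_at_rmorph (R S : nzRingType) (f : {rmorphism R -> S}) h A i j :
  f (Qrel_at h A i j) = Qrel_at (f \o h) A i j.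
Proof. by rewrite /Qrel_at !(rmorphD, rmorphB, rmorphM, rmorphXn, rmorphN). Qed.

Lemma eq_Qrel_at (S : nzRingType) (h h' : {set 'I_n} -> S) A i j :
  h =1 h' -> Qrel_at h A i j = Qrel_at h' A i j.
Proof. by move=> e; rewrite /Qrel_at !e. Qed.

(** Two distinct elements of $A$ already give $|A| \ge 2$, as in [Qrels]. *)
Definition Qrep (S : nzRingType) (h : {set 'I_n} -> S) : Prop :=
  h set0 = 0 /\ forall A i j, i \in A -> j \in A -> i != j -> Qrel_at h A i j = 0.

Lemma Qrep_vgen : Qrep (@vgen k n).
Proof.
split=> [|A i j iA jA ij]; first exact: vgen0.
have <- : Qpi (Qrel k A i j) = Qrel_at (@vgen k n) A i j by rewrite -Qrel_at_rmorph.
rewrite -[RHS](rmorph0 (@Qpi k n)); apply/QpiP; rewrite subr0.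
apply: sub_ideal_gen; exists A, i, j; split=> //.
by rewrite (cardD1 i) (cardD1 j) iA !inE eq_sym ij jA.
Qed.

Section Lift.
Variables (S : algType k) (h : {set 'I_n} -> S) (hQ : Qrep h).

Local Notation L := (@freealg_lift k (Qgen n) S (h \o val)).

Lemma Qlift_Qvar A : L (Qvar k A) = h A.
Proof.
rewrite /Qvar; case: insubP => [g _ <-|]; first exact: freealg_liftE.
by rewrite negbK => /eqP ->; rewrite rmorph0 hQ.1.
Qed.

Lemma Qlift_ideal x : ideal_gen (@Qrels k n) x -> L x = 0.
Proof.
case=> s [Ss ->]; rewrite rmorph_sum big_seq big1 // => t /Ss [A [i [j [_ iA jA ij E]]]].
rewrite !rmorphM /= E [X in _ * X * _](_ : _ = Qrel_at h A i j).
  by rewrite hQ.2 // mulr0 mul0r.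
by rewrite (@Qrel_at_rmorph _ _ L); apply: eq_Qrel_at => B /=; apply: Qlift_Qvar.
Qed.

(** Evaluation on a chosen representative; [Qlift_pi] gives independence of the choice. The proof of
    [Qrep h] is an argument so that the morphism structures below can depend on it. *)
Definition Qlift of Qrep h := fun u : Qalg k n => L (generic_quotient.repr u).

Lemma Qlift_pi x : Qlift hQ (Qpi x) = L x.
Proof. by have := Qlift_ideal (Qpi_repr x); rewrite rmorphB => /eqP; rewrite subr_eq0 => /eqP. Qed.

Lemma Qlift_zmod : zmod_morphism (Qlift hQ).
Proof.
move=> u v; have [x ->] := Qpi_surj u; have [y ->] := Qpi_surj v.
by rewrite -rmorphB !Qlift_pi rmorphB.
Qed.

Lemma Qlift_monoid : monoid_morphism (Qlift hQ).
Proof.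
split=> [|u v]; first by rewrite -[1](rmorph1 (@Qpi k n)) Qlift_pi rmorph1.
have [x ->] := Qpi_surj u; have [y ->] := Qpi_surj v.
by rewrite -rmorphM !Qlift_pi rmorphM.
Qed.

Lemma Qlift_scalable : scalable (Qlift hQ).
Proof.
move=> c u; have [x ->] := Qpi_surj u.
by rewrite -linearZ !Qlift_pi linearZ.
Qed.

HB.instance Definition _ :=
  GRing.isZmodMorphism.Build (Qalg k n) S (Qlift hQ) Qlift_zmod.
HB.instance Definition _ :=
  GRing.isMonoidMorphism.Build (Qalg k n) S (Qlift hQ) Qlift_monoid.
HB.instance Definition _ :=
  GRing.isScalable.Build k (Qalg k n) S *:%R (Qlift hQ) Qlift_scalable.

Lemma Qlift_vgen A : Qlift hQ (vgen k A) = h A.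
Proof. by rewrite Qlift_pi Qlift_Qvar. Qed.
End Lift.
End QLift.

(** * Pairs of weights satisfying the quadratic relations *)

Section QuadPair.
Variables (k : fieldType) (n : nat).
Implicit Types (A B X Y : {set 'I_n}) (i j : 'I_n) (p q : {set 'I_n} -> k).

(* Exactly the condition for v_A |-> p(A) E_01 + q(A) E_12 to define a
   representation of Q_n by 3 x 3 matrices; see [Qrep_utri]. *)
Definition quad_pair p q : Prop :=
  [/\ p set0 = 0, q set0 = 0 & forall A i j, i \in A -> j \in A -> i != j ->
    p A * (q (A :\ i) - q (A :\ j)) - p (A :\ i) * q (A :\ i)
    + p (A :\ j) * q (A :\ j) + (p (A :\ i) - p (A :\ j)) * q (A :\ i :\ j) = 0].

Definition dirac X : {set 'I_n} -> k := fun B => (B == X)%:R.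

Lemma neq_setD1 A i : i \in A -> (A :\ i == A) = false.
Proof. by move=> iA; apply/eqP => /setP/(_ i); rewrite !inE eqxx iA. Qed.

Lemma eq_setD1 A i j : i \in A -> (A :\ i == A :\ j) = (i == j).
Proof.
move=> iA; apply/eqP/eqP => [/setP/(_ i)|->//].
by rewrite !inE eqxx iA andbT /=; case: eqP.
Qed.

(** Every term of the relation is a product $p(B) q(B \setminus l)$, where $l$ may lie outside $B$,
    as in the terms $p(A \setminus i) q(A \setminus i)$. Such a product is nonzero only if $B = X$
    and $Y = X \setminus l$. *)
Lemma quad_pair_dirac X Y : X != set0 -> Y != set0 ->
  (forall i, Y != X :\ i) -> quad_pair (dirac X) (dirac Y).
Proof.
move=> X0 Y0 XY; split=> [||A i j iA jA ij].
- by rewrite /dirac eq_sym (negPf X0).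
- by rewrite /dirac eq_sym (negPf Y0).
rewrite /dirac.
have E B l : ((B == X)%:R * (B :\ l == Y)%:R = 0 :> k).
  by case: eqP => [->|]; rewrite ?mul0r // eq_sym (negPf (XY l)) mulr0.
have E' l : ((A :\ l == X)%:R * (A :\ l == Y)%:R = 0 :> k).
  rewrite -[X in _ * (X == Y)%:R](_ : A :\ l :\ l = A :\ l) ?E //.
  by apply/setP=> m; rewrite !inE; case: eqP.
have C : A :\ j :\ i = A :\ i :\ j by rewrite !setDDl setUC.
have := E (A :\ j) i; rewrite C mulrBr mulrBl (E A i) (E A j) (E' i) (E' j).
by rewrite (E (A :\ i) j) => ->; ring.
Qed.

(* With a Dirac mass in the other slot, these two weights take the row and column
   sums of a quadratic relation, which vanish (for rows, when #|X| >= 2). *)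
Definition row_weight X : {set 'I_n} -> k := fun B => ((B \subset X) && (#|X| <= #|B|.+1)%N)%:R.
Definition col_weight X : {set 'I_n} -> k := fun B => ((X \subset B) && (#|B| <= #|X|.+1)%N)%:R.

(** The weight is 1 at $X$ and at every $X \setminus l$. If $A = X$, the difference multiplying
    $p(A)$ is $1 - 1$; otherwise $p(A) = 0$ and $p(B) q(B) = p(B) q(B \setminus l)$ makes the
    remaining terms cancel. *)
Lemma quad_pair_row X : (2 <= #|X|)%N -> quad_pair (dirac X) (row_weight X).
Proof.
move=> X2; split=> [||A i j iA jA ij].
- by rewrite /dirac eq_sym -cards_eq0; case: #|X| X2.
- by rewrite /row_weight cards0 leqNgt X2 andbF.
have R l : row_weight X (X :\ l) = 1.
  rewrite /row_weight subsetDl (cardsD1 l X).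
  by case: (l \in X); rewrite ?add1n ?leqnn // add0n leqnSn.
have R0 : row_weight X X = 1 by rewrite /row_weight subxx leqnSn.
have [AX|AX] := eqVneq A X.
  by rewrite AX in iA jA *; rewrite !R /dirac !neq_setD1 //; ring.
rewrite {1}/dirac (negPf AX) mul0r sub0r mulrBl.
have E B l : dirac X B * row_weight X B = dirac X B * row_weight X (B :\ l).
  by rewrite /dirac; case: eqP => [->|]; rewrite ?mul0r // R R0.
rewrite (E _ j) (E (A :\ j) i) [A :\ j :\ i](_ : _ = A :\ i :\ j); first by ring.
by rewrite !setDDl setUC.
Qed.

(** The weight is 1 at every $B$ with $B \setminus l = X$. Hence $p(A) q(A \setminus l) = p(A
    \setminus l) q(A \setminus l)$, and when $A \setminus \{i,j\} = X$ both weights in the last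
    difference are 1. *)
Lemma quad_pair_col X : X != set0 -> quad_pair (col_weight X) (dirac X).
Proof.
move=> X0; split=> [||A i j iA jA ij].
- by rewrite /col_weight subset0 (negPf X0).
- by rewrite /dirac eq_sym (negPf X0).
have C0 : col_weight X X = 1 by rewrite /col_weight subxx leqnSn.
have C B l : B :\ l = X -> col_weight X B = 1.
  move=> <-; rewrite /col_weight subsetDl (cardsD1 l B).
  by case: (l \in B); rewrite ?add1n ?leqnn // add0n leqnSn.
have E l : col_weight X A * dirac X (A :\ l) = col_weight X (A :\ l) * dirac X (A :\ l).
  rewrite /dirac; case: eqP => [e|]; last by rewrite !mulr0.
  by rewrite e C0 (C A l).
have -> : (col_weight X (A :\ i) - col_weight X (A :\ j)) * dirac X (A :\ i :\ j) = 0.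
  rewrite /dirac; case: eqP => [e|]; last by rewrite mulr0.
  rewrite (C _ j) // (C _ i) ?subrr ?mul0r // -e.
  by rewrite !setDDl setUC.
by rewrite mulrBr !E; ring.
Qed.

Lemma imset_perm_setD1 (s : 'S_n) A i : s @: (A :\ i) = s @: A :\ s i.
Proof.
apply/setP=> x; rewrite -[x](permKV s) !inE !(mem_imset _ _ (@perm_inj _ s)) !inE.
by rewrite (inj_eq (@perm_inj _ s)).
Qed.

Lemma quad_pair_perm (s : 'S_n) p q :
  quad_pair p q -> quad_pair (fun A => p (s @: A)) (fun A => q (s @: A)).
Proof.
case=> p0 q0 H; split=> [||A i j iA jA ij]; rewrite ?imset0 //.
rewrite !imset_perm_setD1; apply: H; rewrite ?mem_imset ?(inj_eq (@perm_inj _ s)) //;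
  exact: perm_inj.
Qed.
End QuadPair.

(** * Rigidity of the coefficient matrix *)

Section Rigidity.
Variables (k : fieldType) (n : nat).
Implicit Types (A B C X Y : {set 'I_n}) (i j l m : 'I_n) (p q : {set 'I_n} -> k).

(** Reading $p$ as a linear form on the span of the generators, this is $A \mapsto p(f(v_A))$. *)
Definition pull (F : {set 'I_n} -> {set 'I_n} -> k) p : {set 'I_n} -> k :=
  fun A => \sum_B F A B * p B.

(* What is used of F A B = coefficient of v_B in f(v_A), for f an automorphism. *)
Record filtered_pull (F : {set 'I_n} -> {set 'I_n} -> k) : Prop := FilteredPull {
  pull_set0l : forall B, F set0 B = 0;
  pull_set0r : forall A, F A set0 = 0;
  pull_tri : forall A B, (#|A| < #|B|)%N -> F A B = 0;
  pull_pair : forall p q, quad_pair p q -> quad_pair (pull F p) (pull F q);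
  pull_lead : forall a b A B, A != set0 -> A != B ->
    (forall C, (#|A| <= #|C|)%N -> a * F A C + b * F B C = 0) -> a = 0
}.

Lemma pull_dirac F X A : pull F (dirac k X) A = F A X.
Proof.
rewrite /pull (bigD1 X) //= /dirac eqxx mulr1 big1 ?addr0 // => B /negPf ->.
by rewrite mulr0.
Qed.

Section Pull.
Variables (F : {set 'I_n} -> {set 'I_n} -> k) (hF : filtered_pull F).

(** The field [pull_lead] says that $f$ cannot lower the filtration degree of a combination of two
    generators; here the second coefficient is 0. *)
Lemma pull_lead1 A : A != set0 -> exists2 X : {set 'I_n}, #|X| = #|A| & F A X != 0.
Proof.
move=> A0; case: (pickP (fun X : {set 'I_n} => (#|X| == #|A|) && (F A X != 0))) => [X|H].
  by case/andP=> /eqP; exists X.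
suff /eqP : (1 : k) = 0 by rewrite oner_eq0.
apply: (pull_lead hF (b := 0) (B := set0) A0 A0) => C AC.
rewrite mul0r addr0 mul1r; case: (ltngtP #|A| #|C|) AC => // [AC _|AC _].
  by rewrite (pull_tri hF).
by have:= H C; rewrite /= AC eqxx /= => /eqP.
Qed.

(** Since $Y \not\subseteq X$, the Dirac masses at $X$ and $Y$ form a pair. The coefficients of
    $v_X$ at $A \setminus i$ and $A \setminus j$ vanish by size, so the pulled back relation is
    $F(A,X)(F(A \setminus i,Y) - F(A \setminus j,Y)) = 0$. *)
Lemma pull_setD1_nsub A X Y i j : i \in A -> j \in A -> i != j ->
  #|X| = #|A| -> F A X != 0 -> #|Y|.+1 = #|A| -> ~~ (Y \subset X) ->
  F (A :\ i) Y = F (A :\ j) Y.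
Proof.
move=> iA jA ij XA FAX YA YX.
have XL l : l \in A -> F (A :\ l) X = 0.
  by move=> lA; apply: (pull_tri hF); rewrite XA (cardsD1 l A) lA.
have X0 : X != set0 by rewrite -card_gt0 XA -YA.
have Y0 : Y != set0 by apply: contraNneq YX => ->; rewrite sub0set.
have YD l : Y != X :\ l by apply: contraNneq YX => ->; rewrite subsetDl.
have [_ _ /(_ A i j iA jA ij)] := pull_pair hF (quad_pair_dirac k X0 Y0 YD).
rewrite !pull_dirac !XL // !mul0r subr0 !subrr !mul0r !addr0 => /eqP.
by rewrite mulf_eq0 (negPf FAX) subr_eq0 => /eqP.
Qed.

(** Same computation with the row weight of $X$: it controls the subsets of $X$ that
    [pull_setD1_nsub] leaves out. *)
Lemma pull_setD1_row A X i j : i \in A -> j \in A -> i != j ->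
  #|X| = #|A| -> F A X != 0 ->
  \sum_Y (F (A :\ i) Y - F (A :\ j) Y) * row_weight k X Y = 0.
Proof.
move=> iA jA ij XA FAX.
have XL l : l \in A -> F (A :\ l) X = 0.
  by move=> lA; apply: (pull_tri hF); rewrite XA (cardsD1 l A) lA.
have X2 : (2 <= #|X|)%N.
  by rewrite XA (cardsD1 i A) (cardsD1 j (A :\ i)) !inE iA jA eq_sym ij.
have [_ _ /(_ A i j iA jA ij)] := pull_pair hF (quad_pair_row k X2).
rewrite !pull_dirac !XL // !mul0r subr0 !subrr !mul0r !addr0 => /eqP.
rewrite mulf_eq0 (negPf FAX) /= /pull -sumrB => /eqP h0; apply: etrans h0.
by apply: eq_bigr => Y _; rewrite mulrBl.
Qed.

(** Otherwise $f(v_{A \setminus i} - v_{A \setminus j})$ would lose its leading part, against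
    [pull_lead]. *)
Lemma pull_setD1_neq A i j : i \in A -> j \in A -> i != j ->
  ~ (forall Y, #|Y|.+1 = #|A| -> F (A :\ i) Y = F (A :\ j) Y).
Proof.
move=> iA jA ij H; suff /eqP : (1 : k) = 0 by rewrite oner_eq0.
have Ai0 : A :\ i != set0.
  by apply/set0Pn; exists j; rewrite !inE eq_sym ij.
have cD l : l \in A -> #|A :\ l|.+1 = #|A| by move=> lA; rewrite (cardsD1 l A) lA.
have Aij : A :\ i != A :\ j by rewrite eq_setD1.
apply: (pull_lead hF (b := -1) Ai0 Aij) => C AC.
rewrite mul1r mulN1r; case: (ltngtP #|A :\ i| #|C|) AC => // AC _.
  rewrite !(pull_tri hF) ?subrr // -ltnS cD // -(cD i) //.
by rewrite H ?subrr // -AC cD.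
Qed.

(* Otherwise the top part of f(v_(A :\ i) - v_(A :\ j)) is supported on the subsets
   of both X and X', hence on the single set X :&: X'; its coefficients sum to 0, so
   it vanishes. *)
Lemma pull_lead_unique A X X' : (2 <= #|A|)%N -> #|X| = #|A| -> #|X'| = #|A| ->
  F A X != 0 -> F A X' != 0 -> X = X'.
Proof.
move=> A2 XA X'A FX FX'; apply/eqP/negPn/negP => XX'.
have /card_gt1P [i [j [iA jA ij]]] := A2.
apply: (@pull_setD1_neq A i j) => // Y YA; apply/eqP; rewrite -subr_eq0.
have [YX|YX] := boolP (Y \subset X); last first.
  by rewrite (pull_setD1_nsub (Y := Y) iA jA ij XA FX) ?subrr.
have [YX'|YX'] := boolP (Y \subset X'); last first.
  by rewrite (pull_setD1_nsub (Y := Y) iA jA ij X'A FX') ?subrr.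
have YI : Y = X :&: X'.
  apply/eqP; rewrite eqEcard subsetI YX YX' /= -ltnS YA -XA.
  apply: proper_card; rewrite properEneq subsetIl andbT.
  apply: contraNneq XX' => XI; rewrite eqEcard X'A XA leqnn andbT.
  by rewrite -XI subsetIr.
have := pull_setD1_row iA jA ij XA FX.
rewrite (bigD1 Y) //= big1 ?addr0 => [|Z ZY].
  by rewrite /row_weight YX XA -YA leqnn mulr1 => ->.
rewrite /row_weight; case: (boolP (Z \subset X)) => ZX; last by rewrite mulr0.
case: leqP => XZ; last by rewrite mulr0.
(* The row weight also counts $Z = X$, which is too large to occur in the rows of $A \setminus i$
   and $A \setminus j$. *)
rewrite mulr1; have [ZA|ZA] := eqVneq #|Z|.+1 #|A|; last first.
  have ZlA : (#|A| <= #|Z|)%N.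
    by rewrite -ltnS ltn_neqAle eq_sym ZA -XA XZ.
  rewrite !(pull_tri hF) ?subrr //; apply: leq_trans ZlA.
    by rewrite (cardsD1 j A) jA.
  by rewrite (cardsD1 i A) iA.
rewrite (pull_setD1_nsub (Y := Z) iA jA ij X'A FX') ?subrr //.
apply: contra ZY => ZX'; rewrite YI eqEcard subsetI ZX ZX' /=.
by rewrite -YI -ltnS YA ZA.
Qed.

(** * The case where every coatom is its own leading set *)

Section Diagonal.
Hypothesis n3 : (3 <= n)%N.
Hypothesis coatom : forall i X, #|X|.+1 = n -> F [set~ i] X != 0 -> X = [set~ i].

(** Descending induction on $|A|$. If $A$ misses two elements $i$ and $j$, then $X$ lies in both $A
    \cup \{i\}$ and $A \cup \{j\}$, hence in $A$. Were $X$ not inside $A' = A \cup \{l\}$, whose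
    leading set is $A'$ by induction, then $A$ and $A' \setminus m$ would both have leading set
    $X$. *)
Lemma pull_lead_diag A X : (2 <= #|A|)%N -> #|X| = #|A| -> F A X != 0 -> X = A.
Proof.
have [d] := ubnP (n - #|A|); elim: d A X => // d IH A X nA A2 XA FX.
have cA : (#|A| + #|~: A|)%N = n by rewrite cardsC card_ord.
have [A0|] := posnP #|~: A|.
  have -> : A = setT by apply: setC_inj; rewrite setCT; apply: cards0_eq.
  apply/eqP; rewrite eqEcard subsetT cardsT card_ord XA.
  by move: cA; rewrite A0 addn0 => ->; rewrite leqnn.
rewrite leq_eqVlt => /orP[/eqP/esym/eqP/cards1P [i iA]|/card_gt1P [i [j [iA jA ij]]]].
  have AE : A = [set~ i] by rewrite -iA setCK.
  rewrite {1}AE in FX; rewrite AE; apply: coatom FX.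
  by rewrite XA; move: cA; rewrite iA cards1 addn1.
have sub l : l \in ~: A -> X \subset l |: A.
  rewrite inE => lA; set A' := l |: A.
  have cA' : #|A'| = #|A|.+1 by rewrite cardsU1 lA.
  have A'0 : A' != set0 by rewrite -card_gt0 cA'.
  have [X' X'A' FX'] := pull_lead1 A'0.
  have A'n : (#|A'| <= n)%N by have := max_card (mem A'); rewrite card_ord.
  have eX' : X' = A'.
    apply: IH => //; last by rewrite cA' ltnW.
    by rewrite cA'; rewrite cA' in A'n; rewrite -ltnS subnSK // (leq_trans _ nA) // ltnS.
  rewrite {}eX' in X'A' FX'; apply: contraT => XA''.
  have /card_gt0P [m mA] : (0 < #|A|)%N by apply: ltnW.
  have ml : m != l by apply: contraNneq lA => <-.
  have lA' : l \in A' by rewrite !inE eqxx.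
  have mA' : m \in A' by rewrite !inE mA orbT.
  have Al : A' :\ l = A.
    by apply/setP=> x; rewrite !inE; case: eqP => // ->; rewrite (negPf lA).
  have cm : #|A' :\ m| = #|A|.
    by apply/eqP; rewrite -eqSS -cA' (cardsD1 m A') mA'.
  have e : F (A' :\ m) X = F A X.
    by rewrite -Al (pull_setD1_nsub mA' lA' ml X'A' FX') // XA cA'.
  have Fm : F (A' :\ m) X != 0 by rewrite e.
  have Am : A != A' :\ m by rewrite -[X in X != _]Al eq_setD1 // eq_sym.
  have A0 : A != set0 by apply/set0Pn; exists m.
  suff : F (A' :\ m) X = 0 by move/eqP; rewrite (negPf Fm).
  (* These coefficients cancel at $X$, the only leading set of both rows by [pull_lead_unique]. *)
  apply: (pull_lead hF (b := - F A X) A0 Am) => C AC.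
  have [->|CX] := eqVneq C X; first by rewrite mulrC mulNr subrr.
  have [CA|CA] := eqVneq #|C| #|A|; last first.
    have AC' : (#|A| < #|C|)%N by rewrite ltn_neqAle AC eq_sym CA.
    by rewrite (pull_tri hF AC') (@pull_tri _ hF (A' :\ m) C) ?cm // !mulr0 addr0.
  have z A1 : #|A1| = #|A| -> F A1 X != 0 -> F A1 C = 0.
    move=> c1 F1; apply/eqP; apply: contraNT CX => F2.
    by apply/eqP/(@pull_lead_unique A1); rewrite ?c1.
  by rewrite (z A) // (z (A' :\ m)) // !mulr0 addr0.
apply/eqP; rewrite eqEcard XA leqnn andbT; apply/subsetP=> x xX.
have := subsetP (sub _ iA) x xX; have := subsetP (sub _ jA) x xX.
by rewrite !inE; case: (x \in A); rewrite ?orbF ?orbT // => /eqP -> /eqP e; rewrite e eqxx in ij.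
Qed.

Lemma setD1_set2l i j : i != j -> [set i; j] :\ i = [set j].
Proof.
move=> ij; apply/setP=> x; rewrite !inE.
by case: (eqVneq x i) => //= ->; rewrite (negPf ij).
Qed.

Lemma setD1_set2r i j : i != j -> [set i; j] :\ j = [set i].
Proof. by rewrite eq_sym setUC; apply: setD1_set2l. Qed.

Lemma pull_edge_diag i j : i != j -> F [set i; j] [set i; j] != 0.
Proof.
move=> ij; have c2 : #|[set i; j]| = 2 by rewrite cards2 ij.
have [|X XA FX] := @pull_lead1 [set i; j]; first by rewrite -card_gt0 c2.
have XE : X = [set i; j] by apply: pull_lead_diag FX; rewrite ?c2 // XA.
by rewrite XE in FX.
Qed.

Lemma pull_atom_other i j l : i != j -> l != i -> l != j ->
  F [set i] [set l] = F [set j] [set l].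
Proof.
move=> ij li lj; have iA := set21 i j; have jA := set22 i j.
have := @pull_setD1_nsub _ _ [set l] _ _ iA jA ij erefl (pull_edge_diag ij).
rewrite setD1_set2l // setD1_set2r // cards2 ij cards1 sub1set !inE negb_or li lj.
by move=> ->.
Qed.

(** The row sum for $X = \{i,j\}$: singletons outside $X$ contribute nothing by [pull_atom_other],
    larger sets by triangularity. *)
Lemma pull_atom_row i j : i != j ->
  F [set i] [set i] + F [set i] [set j] = F [set j] [set i] + F [set j] [set j].
Proof.
move=> ij; have iA := set21 i j; have jA := set22 i j.
apply/esym/eqP; rewrite -subr_eq0 opprD addrACA; apply/eqP.
have := pull_setD1_row iA jA ij erefl (pull_edge_diag ij).
rewrite setD1_set2l // setD1_set2r // => row; apply: etrans row.
rewrite (bigD1 [set i]) // (bigD1 [set j]) /=; last first.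
  by rewrite (inj_eq set1_inj) eq_sym.
rewrite big1 ?addr0 => [|Y /andP[Yi Yj]].
  by rewrite /row_weight cards2 ij !cards1 !sub1set iA jA !mulr1.
case: (ltnP 1 #|Y|) => Y1; first by rewrite !(pull_tri hF) ?cards1 // subrr mul0r.
case: (posnP #|Y|) => Y0.
  by rewrite (cards0_eq Y0) !(pull_set0r hF) subrr mul0r.
have /cards1P [y Ey] : #|Y| == 1%N by rewrite eqn_leq Y1.
rewrite Ey (pull_atom_other ij) ?subrr ?mul0r //.
  by apply: contraNneq Yi => <-; rewrite Ey.
by apply: contraNneq Yj => <-; rewrite Ey.
Qed.

(** As $n \ge 3$, some $j$ differs from $i$ and $m$. The rows of $i$ and $j$ agree at $m$, so the
    relation of $\{i,j\}$ for the Dirac masses at $i$ and $m$ becomes $(F(i,i) - F(j,i)) F(i,m) =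
    0$. *)
Lemma pull_atom_diag i m : i != m -> F [set i] [set m] = 0.
Proof.
move=> im.
have [j] : exists j, j \notin [set i; m].
  apply/existsP; rewrite -negb_forall; apply/negP => /forallP H.
  have : (#|[set: 'I_n]| <= #|[set i; m]|)%N.
    by apply/subset_leq_card/subsetP=> x _; apply: H.
  by rewrite cardsT card_ord cards2 im leqNgt n3.
rewrite !inE negb_or => /andP[ji jm].
have ij : i != j by rewrite eq_sym.
have iA := set21 i j; have jA := set22 i j.
have other := pull_atom_other ij.
(* Equality at $i$ would spread to $j$ by [pull_atom_row] and already holds elsewhere, so the
   leading parts would coincide. *)
have neq : F [set i] [set i] - F [set j] [set i] != 0.
  apply/negP; rewrite subr_eq0 => /eqP e.
  apply: (pull_setD1_neq iA jA ij) => Y.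
  rewrite cards2 ij setD1_set2l // setD1_set2r // => -[] /eqP/cards1P [y ->].
  have [->//|yi] := eqVneq y i; have [->|yj] := eqVneq y j.
    by have := pull_atom_row ij; rewrite e => /addrI.
  by rewrite other.
have i0 : [set i] != set0 by rewrite -card_gt0 cards1.
have m0 : [set m] != set0 by rewrite -card_gt0 cards1.
have imD l : [set m] != [set i] :\ l.
  by apply/eqP => /setP/(_ m); rewrite !inE eqxx [m == i]eq_sym (negPf im) andbF.
have [_ _ /(_ _ i j iA jA ij)] := pull_pair hF (quad_pair_dirac k i0 m0 imD).
rewrite !pull_dirac setD1_set2l // setD1_set2r // setDv (pull_set0l hF).
rewrite other 1?[m == _]eq_sym // subrr !(mulr0, addr0) add0r addrC -mulrBl => /eqP.
by rewrite mulf_eq0 (negPf neq) => /eqP.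
Qed.

Lemma pull_atom_const i j : F [set i] [set i] = F [set j] [set j].
Proof.
have [->//|ij] := eqVneq i j; have := pull_atom_row ij.
by rewrite (pull_atom_diag ij) (@pull_atom_diag j i) 1?eq_sym // addr0 add0r.
Qed.

Lemma pull_scalar : exists2 c, c != 0 & forall A B, A != set0 -> F A B = c *+ (A == B).
Proof.
pose i0 : 'I_n := Ordinal (ltnW (ltnW n3)).
pose c := F [set i0] [set i0].
suff H A B : A != set0 -> F A B = c *+ (A == B).
  have A0 : [set i0] != set0 by rewrite -card_gt0 cards1.
  by exists c => //; have [X _] := pull_lead1 A0; rewrite H //; case: (_ == X); rewrite ?eqxx.
have [d] := ubnP #|A|; elim: d A B => // d IH A B Ad A0.
have [->|B0] := eqVneq B set0; first by rewrite (pull_set0r hF) (negPf A0).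
have : (0 < #|A|)%N by rewrite card_gt0.
rewrite leq_eqVlt => /orP[/eqP/esym/eqP/cards1P [i Ai]|A2].
  rewrite Ai; case: (ltnP 1 #|B|) => B1.
    rewrite (pull_tri hF) ?cards1 //; case: eqP => // e.
    by rewrite -e cards1 in B1.
  have /cards1P [b ->] : #|B| == 1%N by rewrite eqn_leq B1 card_gt0.
  rewrite (inj_eq set1_inj); have [<-|ib] := eqVneq i b; first exact: pull_atom_const.
  exact: pull_atom_diag.
have cD l : l \in A -> #|A :\ l|.+1 = #|A| by move=> lA; rewrite (cardsD1 l A) lA.
have D0 l : l \in A -> A :\ l != set0.
  by move=> lA; rewrite -card_gt0 -ltnS cD.
have IHD l X : l \in A -> F (A :\ l) X = c *+ (A :\ l == X).
  by move=> lA; apply: IH; rewrite ?D0 // -ltnS cD // -ltnS.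
(* By induction the row of $A \setminus i$ has no nonzero entry other than [c], and [pull_lead1]
   supplies one. *)
have c0 : c != 0.
  have [i iA] := set0Pn _ A0; have [X _] := pull_lead1 (D0 i iA).
  by rewrite IHD //; case: (_ == X); rewrite ?eqxx.
have neD i j : j \in A -> i != j -> F (A :\ i :\ j) (A :\ i) = 0.
  move=> jA ij; apply: (pull_tri hF).
  by rewrite [X in (_ < X)%N](cardsD1 j) !inE jA eq_sym ij.
have offdiag X : X != set0 -> X != A -> F A X = 0.
  move=> X0 XA; case: (ltngtP #|A| #|X|) => AX.
  - exact: (pull_tri hF).
  (* For $X$ smaller than $A$, an $i$ with $X \ne A \setminus i$ reduces the relation for the Dirac
     masses at $X$ and $A \setminus i$ to $F(A,X) c = 0$. *)
  - have [i [j [iA jA ij XAi]]] : exists i j, [/\ i \in A, j \in A, i != j & X != A :\ i].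
      have /card_gt1P [i [j [iA jA ij]]] := A2.
      have [XAi|XAi] := eqVneq X (A :\ i); last by exists i, j.
      by exists j, i; split; rewrite 1?eq_sym // XAi eq_sym eq_setD1.
    have XD l : A :\ i != X :\ l.
      apply: contraNneq XAi => e; rewrite e eq_sym eqEcard subsetDl -e.
      by rewrite -ltnS cD.
    have [_ _ /(_ A i j iA jA ij)] := pull_pair hF (quad_pair_dirac k X0 (D0 i iA) XD).
    rewrite !pull_dirac !IHD // neD // eqxx [A :\ i == X]eq_sym (negPf XAi).
    rewrite eq_setD1 // [j == i]eq_sym (negPf ij).
    rewrite !mulr0n !(mulr0, mul0r) !subr0 !addr0 => /eqP.
    by rewrite mulf_eq0 (negPf c0) orbF => /eqP.
  - apply/eqP; apply: contraNT XA => FX; apply/eqP.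
    exact: pull_lead_diag FX.
have [AB|AB] := eqVneq A B; last by rewrite offdiag // eq_sym.
rewrite -{}AB mulr1n {B B0}.
have /card_gt1P [i [j [iA jA ij]]] := A2.
(* The column weight pulls back to $F(A,A)$ at $A$, to $c$ at $A \setminus i$ and to 0 at $A
   \setminus j$, so the relation reads $(F(A,A) - c) c = 0$. *)
have [_ _ /(_ A i j iA jA ij)] := pull_pair hF (quad_pair_col k (D0 i iA)).
have PA : pull F (col_weight k (A :\ i)) A = F A A.
  rewrite /pull (bigD1 A) //= big1 ?addr0 => [|X XA].
    by rewrite /col_weight subsetDl cD // leqnn mulr1.
  have [->|X0] := eqVneq X set0; first by rewrite (pull_set0r hF) mul0r.
  by rewrite offdiag // mul0r.
have PD l : l \in A -> pull F (col_weight k (A :\ i)) (A :\ l) = c * (l == i)%:R.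
  move=> lA; rewrite /pull (bigD1 (A :\ l)) //= big1 ?addr0 => [|X XA].
    rewrite IHD // eqxx mulr1n; congr (_ * _); rewrite /col_weight.
    have e : #|A :\ l| = #|A :\ i| by apply/eqP; rewrite -eqSS !cD.
    by rewrite e leqnSn andbT -(eq_setD1 i lA) eq_sym eqEcard e leqnn andbT.
  by rewrite IHD // eq_sym (negPf XA) mul0r.
rewrite PA !PD // !pull_dirac !IHD // neD // !eqxx eq_setD1 // [j == i]eq_sym (negPf ij).
rewrite mulr0n !(mulr0, mul0r) !subr0 !addr0 mulr1 mulr1n -mulrBl => /eqP.
by rewrite mulf_eq0 (negPf c0) orbF subr_eq0 => /eqP.
Qed.
End Diagonal.
(** For $n \ge 3$ coatoms have at least two elements, so their leading sets are unique; these are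
    again coatoms, which defines a map on indices. *)
Lemma pull_coatom_perm : (3 <= n)%N -> exists s : 'S_n,
  forall i X, #|X|.+1 = n -> F [set~ i] X != 0 -> X = [set~ s i].
Proof.
move=> n3; have cc i : #|[set~ i]|.+1 = n.
  by rewrite cardsC1 card_ord prednK // ltnW // ltnW.
have cc0 i : [set~ i] != set0 by rewrite -card_gt0 -ltnS cc ltnW.
have cc2 i : (2 <= #|[set~ i]|)%N by rewrite -ltnS cc.
have [t Ht] : exists t : 'I_n -> 'I_n, forall i, F [set~ i] [set~ t i] != 0.
  apply: (fin_all_exists (P := fun i j => F [set~ i] [set~ j] != 0)) => i.
  have [X Xi FX] := pull_lead1 (cc0 i).
  have /cards1P [j Xj] : #|~: X| == 1%N.
    by rewrite -(eqn_add2l #|X|) cardsC card_ord addn1 Xi cc.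
  by exists j; rewrite -Xj setCK.
have Hu i X : #|X|.+1 = n -> F [set~ i] X != 0 -> X = [set~ t i].
  move=> Xn FX; apply: (pull_lead_unique (cc2 i)) (Ht i) => //; apply/eqP;
  by rewrite -eqSS !cc ?Xn.
have tI : injective t.
  move=> i j tij; apply/eqP; apply: contraT => ij.
  have ij' : [set~ i] != [set~ j].
    by apply: contraNneq ij => /setC_inj/set1_inj ->.
  suff : F [set~ j] [set~ t j] = 0 by move/eqP; rewrite (negPf (Ht j)).
  (* Two coatoms with the same leading set would have proportional leading parts; the coefficients
     are chosen to cancel them. *)
  apply: (pull_lead hF (b := - F [set~ i] [set~ t i]) (cc0 i) ij') => C iC.
  have [->|CX] := eqVneq C [set~ t i]; first by rewrite -tij mulrC mulNr subrr.
  have z l : t l = t i -> F [set~ l] C = 0.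
    move=> tl; have [Cl|Cl] := eqVneq #|C|.+1 n; last first.
      apply: (pull_tri hF); rewrite -ltnS cc ltn_neqAle eq_sym Cl.
      by move: iC; rewrite -ltnS cc.
    apply/eqP; apply: contraNT CX => FC.
    by rewrite (Hu l C Cl FC) tl.
  by rewrite !z // !mulr0 addr0.
by exists (perm tI) => i X Xn FX; rewrite permE; apply: Hu.
Qed.
End Pull.

(** This is the matrix of $f$ followed by the automorphism of $s^{-1}$, which sends $v_{s(B)}$ to
    $v_B$. *)
Lemma filtered_pull_perm F (s : 'S_n) :
  filtered_pull F -> filtered_pull (fun A B => F A (s @: B)).
Proof.
have sI := @perm_inj _ s; move=> hF; split=> [B|A|A B AB|p q pq|a b A B A0 AB H].
- by rewrite (pull_set0l hF).
- by rewrite imset0 (pull_set0r hF).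
- by apply: (pull_tri hF); rewrite card_imset.
- have sK A : s^-1%g @: (s @: A) = A.
    by rewrite -imset_comp (eq_imset (g := id)) ?imset_id // => x; apply: permK.
  have eF r : pull (fun A B => F A (s @: B)) r =1 pull F (fun A => r (s^-1%g @: A)).
    move=> A; rewrite /pull [RHS](reindex_inj (imset_inj sI)).
    by apply: eq_bigr => B _; rewrite sK.
  have [p0 q0 H] := pull_pair hF (quad_pair_perm s^-1 pq).
  by split=> [||A i j iA jA ij]; rewrite !eF //; apply: H.
- apply: (pull_lead hF (b := b) A0 AB) => C AC.
  have sVK : C = s @: (s^-1%g @: C).
    by rewrite -imset_comp (eq_imset (g := id)) ?imset_id // => x; apply: permKV.
  by rewrite sVK; apply: H; rewrite card_imset //; apply: perm_inj.
Qed.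

Lemma filtered_pull_rigid F : (3 <= n)%N -> filtered_pull F ->
  exists (s : 'S_n) (c : k), c != 0 /\
    forall A B, A != set0 -> F A B = c *+ (s @: A == B).
Proof.
move=> n3 hF; have [s Hs] := pull_coatom_perm hF n3.
have sI := @perm_inj _ s.
have sC i : s @: [set~ i] = [set~ s i].
  apply/setP=> x; rewrite -[x](permKV s) mem_imset ?inE ?(inj_eq sI) //.
have [|c c0 Hc] := pull_scalar (filtered_pull_perm s hF) n3.
  move=> i X Xn FX; apply: (imset_inj sI); rewrite sC; apply: Hs FX.
  by rewrite card_imset.
exists s, c; split=> // A B A0.
have -> : B = s @: (s^-1%g @: B).
  by rewrite -imset_comp (eq_imset (g := id)) ?imset_id // => x; apply: permKV.
by rewrite Hc // (inj_eq (imset_inj sI)).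
Qed.
End Rigidity.

(** * Spanning by words in the generators *)

Section Words.
Variables (k : fieldType) (n : nat).
Implicit Types (A B C : {set 'I_n}) (P : seq (Qgen n) -> Prop) (u v : Qalg k n).

Lemma vspan_word P w : P w -> vspan (k := k) P (vword k w).
Proof.
move=> Pw; exists [:: (1, w)]; split=> [t|]; first by rewrite inE => /eqP ->.
by rewrite big_seq1 scale1r.
Qed.

Lemma vspan0 P : vspan P (0 : Qalg k n).
Proof. by exists [::]; split=> //; rewrite big_nil. Qed.

Lemma vspanD P u v : vspan P u -> vspan P v -> vspan P (u + v).
Proof.
move=> [s [Ps ->]] [t [Pt ->]]; exists (s ++ t); split; last by rewrite big_cat.
by move=> x; rewrite mem_cat => /orP[/Ps|/Pt].
Qed.

Lemma vspanZ P c u : vspan P u -> vspan P (c *: u).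
Proof.
move=> [s [Ps ->]]; exists [seq (c * t.1, t.2) | t <- s]; split.
  by move=> x /mapP[t /Ps Pt ->].
by rewrite big_map scaler_sumr; apply: eq_bigr => t _; rewrite scalerA.
Qed.

Lemma vspan_sum P (I : eqType) (r : seq I) (E : I -> Qalg k n) :
  (forall i, i \in r -> vspan P (E i)) -> vspan P (\sum_(i <- r) E i).
Proof.
move=> H; rewrite big_seq; elim/big_ind: _ => //; first exact: vspan0.
by move=> x y; apply: vspanD.
Qed.

(** The free algebra is spanned by monomials, and a monomial maps to the word with the same
    letters. *)
Lemma vspanT u : vspan (fun=> True) u.
Proof.
have [x ->] := Qpi_surj u; rewrite (monalgE x) rmorph_sum /=.
apply: vspan_sum => m _.
have -> : << x@_m *g m >> = x@_m *: (<< m >> : freealg k (Qgen n)).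
  by rewrite -mul_malgC malgM_def fgmulUU mulr1 mul1m.
rewrite linearZ /=; apply: vspanZ.
rewrite (_ : Qpi _ = vword k (m : seq _)); first exact: vspan_word.
case: m => s; elim: s => [|g s IH].
  by rewrite /vword big_nil -(rmorph1 (@Qpi k n)) -fmoneE.
rewrite /vword big_cons -[X in _ * X]IH /vgen /Qvar valK -rmorphM; congr Qpi.
by rewrite /freegen malgM_def fgmulUU mul1r; congr << _ >>; rewrite fmuE [RHS]fmmulE.
Qed.

Lemma eq_on_vgen (S : algType k) (f g : {lrmorphism Qalg k n -> S}) :
  (forall A, f (vgen k A) = g (vgen k A)) -> f =1 g.
Proof.
move=> H u; have [s [_ ->]] := vspanT u.
rewrite !linear_sum; apply: eq_bigr => t _; rewrite !linearZ; congr (_ *: _).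
by rewrite !rmorph_prod; apply: eq_bigr => x _; apply: H.
Qed.

Lemma vword_cons (g : Qgen n) w : vword k (g :: w) = vgen k (val g) * vword k w.
Proof. by rewrite /vword big_cons. Qed.

End Words.

(** * Triangular representations and linear coordinates on $Q_n$ *)

Section Triangular.
Variables (k : fieldType) (n : nat).
Implicit Types (A B C : {set 'I_n}) (p q : {set 'I_n} -> k).

(** Here [ord_max] is the index 2, so a product of two such matrices is a multiple of $E_{02}$. *)
Definition utri (a b : k) : 'M[k]_3 :=
  a *: delta_mx 0 1 + b *: delta_mx 1 ord_max.

Lemma utriB a b c d : utri a b - utri c d = utri (a - c) (b - d).
Proof. by rewrite /utri !scalerBl opprD addrACA. Qed.

Lemma utriZ c a b : c *: utri a b = utri (c * a) (c * b).
Proof. by rewrite /utri scalerDr !scalerA. Qed.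

Lemma utri_sum (I : finType) (a b : I -> k) :
  \sum_i utri (a i) (b i) = utri (\sum_i a i) (\sum_i b i).
Proof. by rewrite big_split /= -!scaler_suml. Qed.

Lemma utriM a b c d : utri a b * utri c d = (a * d) *: delta_mx 0 ord_max.
Proof.
rewrite /utri mulrDl !mulrDr -!scalerAl -!scalerAr -![delta_mx _ _ * _]/(_ *m _).
rewrite mul_delta_mx !mul_delta_mx_0 // !scaler0 !addr0 add0r scalerA.
by [].
Qed.

Lemma utri01 a b : utri a b 0 1 = a.
Proof. by rewrite !mxE /= mulr1 mulr0 addr0. Qed.

Lemma Qrep_utri p q : Qrep (fun A => utri (p A) (q A)) <-> quad_pair p q.
Proof.
have E A i j : Qrel_at (fun A => utri (p A) (q A)) A i j =
    (p A * (q (A :\ i) - q (A :\ j)) - p (A :\ i) * q (A :\ i)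
    + p (A :\ j) * q (A :\ j) + (p (A :\ i) - p (A :\ j)) * q (A :\ i :\ j))
      *: delta_mx 0 ord_max.
  by rewrite /Qrel_at !expr2 !utriB !utriM -scalerBl -!scalerDl.
split=> [[h0 H]|[p0 q0 H]].
  have p0 : p set0 = 0 by rewrite -(utri01 (p set0) (q set0)) h0 mxE.
  split=> // [|A i j iA jA ij].
    by have := congr1 (fun M : 'M_3 => M 1 ord_max) h0; rewrite !mxE /= p0 mulr0 mulr1 add0r.
  have := H A i j iA jA ij; rewrite E => /(congr1 (fun M : 'M_3 => M 0 ord_max)).
  by rewrite !mxE /= mulr1.
split=> [|A i j iA jA ij]; first by rewrite p0 q0 /utri !scale0r addr0.
by rewrite E H // scale0r.
Qed.

Lemma quad_pair_coef B :
  quad_pair (fun A => ((A != set0) && (A == B))%:R : k) (fun=> 0).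
Proof. by split=> [||A i j _ _ _]; rewrite ?eqxx //; ring. Qed.

Definition vrep B : {lrmorphism Qalg k n -> 'M[k]_3} :=
  Qlift ((Qrep_utri _ _).2 (quad_pair_coef B)).

(** In the representation with $q = 0$ all words of length at least 2 act by 0. Its entry at $(0,1)$
    is thus a well-defined coefficient of $v_B$ on the quotient, which also shows that the $v_A$
    with $A$ nonempty are linearly independent. *)
Definition vcoef B (u : Qalg k n) : k := vrep B u 0 1.

Lemma vcoef_linear B : linear_for *%R (vcoef B).
Proof. by move=> c u v; rewrite /vcoef linearP !mxE. Qed.

HB.instance Definition _ B :=
  GRing.isLinear.Build k (Qalg k n) k *%R (vcoef B) (vcoef_linear B).

Lemma vcoef_comb B a b u v :
  vcoef B (a *: u + b *: v) = a * vcoef B u + b * vcoef B v.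
Proof. by rewrite linearP linearZ. Qed.

Lemma vrep_vgen B A : vrep B (vgen k A) = utri ((A != set0) && (A == B))%:R 0.
Proof. exact: Qlift_vgen. Qed.

Lemma vcoef_vgen B A : vcoef B (vgen k A) = ((A != set0) && (A == B))%:R.
Proof. by rewrite /vcoef vrep_vgen utri01. Qed.

Lemma vcoef_vword B (w : seq (Qgen n)) :
  vcoef B (vword k w) = if w is [:: g] then (val g == B)%:R else 0.
Proof.
rewrite /vword; case: w => [|g [|g' w]].
- by rewrite big_nil /vcoef rmorph1 mxE.
- by rewrite big_seq1 vcoef_vgen (valP g).
rewrite !big_cons mulrA /vcoef !rmorphM /= !vrep_vgen utriM mulr0 scale0r.
by rewrite mul0r mxE.
Qed.

Lemma Qgrade1E (u : Qalg k n) : Qgrade 1 u -> u = \sum_B vcoef B u *: vgen k B.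
Proof.
move=> [s [sz ->]].
under [RHS]eq_bigr => B _ do rewrite linear_sum scaler_suml.
rewrite exchange_big big_seq [RHS]big_seq /=; apply: eq_bigr => t /sz.
case: t => c [|g [|? ?]] //= _.
rewrite (bigD1 (val g)) //= big1 ?addr0 => [|B Bg].
  by rewrite linearZ /= vcoef_vword eqxx mulr1 /vword big_seq1.
by rewrite linearZ /= vcoef_vword eq_sym (negPf Bg) mulr0 scale0r.
Qed.

(** Only one-letter words contribute to [vcoef], and those in the span have letters of size at most
    $d$. *)
Lemma vcoef_Qfilt d B (u : Qalg k n) : (d < #|B|)%N -> Qfilt d u -> vcoef B u = 0.
Proof.
move=> dB [s [sw ->]]; rewrite linear_sum big_seq big1 // => t /sw.
rewrite linearZ /= vcoef_vword; case: t => c [|g [|? ?]] /=; rewrite ?mulr0 //.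
rewrite big_seq1; case: eqP; rewrite ?mulr0 // => -> Bd.
by rewrite ltnNge Bd in dB.
Qed.

Lemma Qgrade_vgen A : Qgrade 1 (vgen k A).
Proof.
have [->|A0] := eqVneq A set0; first by rewrite vgen0; apply: vspan0.
rewrite (_ : vgen k A = vword k [:: Sub A A0]); first exact: vspan_word.
by rewrite /vword big_seq1.
Qed.

Lemma Qfilt_vgen A d : (#|A| <= d)%N -> Qfilt d (vgen k A).
Proof.
have [->|A0 Ad] := eqVneq A set0; first by rewrite vgen0 => _; apply: vspan0.
rewrite (_ : vgen k A = vword k [:: Sub A A0]); last by rewrite /vword big_seq1.
by apply: vspan_word; rewrite big_seq1.
Qed.

Lemma Qfilt_coef d (u : Qalg k n) : Qgrade 1 u ->
  (forall B, (d < #|B|)%N -> vcoef B u = 0) -> Qfilt d u.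
Proof.
move=> u1 H; rewrite (Qgrade1E u1); apply: vspan_sum => B _.
case: (leqP #|B| d) => [Bd|/H ->]; last by rewrite scale0r; apply: vspan0.
exact/vspanZ/Qfilt_vgen.
Qed.
End Triangular.

(** * The coefficient matrix of an automorphism *)

Section Coordinates.
Variables (k : fieldType) (n : nat).
Implicit Types (A B C : {set 'I_n}) (f : Qaut k n).

Lemma Qaut_linear f : linear f.
Proof. by have [] := Qaut_prop f. Qed.

Lemma Qaut_monoid f : monoid_morphism f.
Proof. by have [] := Qaut_prop f. Qed.

HB.instance Definition _ f :=
  GRing.isLinear.Build k (Qalg k n) (Qalg k n) *:%R (Qaut_fun f) (Qaut_linear f).
HB.instance Definition _ f :=
  GRing.isMonoidMorphism.Build (Qalg k n) (Qalg k n) (Qaut_fun f) (Qaut_monoid f).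

Definition Qaut_coef f A B : k := vcoef B (f (vgen k A)).

Lemma Qaut_grade f d u : Qgrade d u -> Qgrade d (f u).
Proof. by have [_ _ _ fG _] := Qaut_prop f => ud; rewrite -fG; exists u. Qed.

Lemma Qaut_filt f d u : Qfilt d u -> Qfilt d (f u).
Proof. by have [_ _ _ _ fF] := Qaut_prop f => ud; rewrite -fF; exists u. Qed.

(** Injectivity of $f$, together with its mapping each filtration step onto itself, makes it reflect
    filtration degree. *)
Lemma Qaut_filtV f d u : Qfilt d (f u) -> Qfilt d u.
Proof.
have [_ _ /bij_inj fI _ fF] := Qaut_prop f.
by rewrite -{1}fF => -[v vd /fI <-].
Qed.

Lemma Qaut_vgen f A : f (vgen k A) = \sum_B Qaut_coef f A B *: vgen k B.
Proof. exact/Qgrade1E/Qaut_grade/Qgrade_vgen. Qed.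

Lemma filtered_pull_Qaut f : filtered_pull (Qaut_coef f).
Proof.
split=> [B|A|A B AB|p q pq|a b A B A0 AB H].
- by rewrite /Qaut_coef vgen0 !linear0.
- rewrite /Qaut_coef Qaut_vgen linear_sum big1 // => B _.
  by rewrite linearZ /= vcoef_vgen; case: eqP => [->|]; rewrite ?eqxx ?andbF mulr0.
- exact/(vcoef_Qfilt AB)/Qaut_filt/Qfilt_vgen.
(* The representation given by $(p,q)$, composed with $f$, is again triangular and has the pulled
   back weights. *)
- have rQ := (Qrep_utri p q).2 pq; apply/Qrep_utri.
  have E A : utri (pull (Qaut_coef f) p A) (pull (Qaut_coef f) q A) = Qlift rQ (f (vgen k A)).
    rewrite Qaut_vgen linear_sum /pull -utri_sum; apply: eq_bigr => B _.
    by rewrite linearZ /= Qlift_vgen utriZ.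
  have [v0 vR] := Qrep_vgen k n; split=> [|A i j iA jA ij]; first by rewrite E v0 !linear0.
  rewrite (eq_Qrel_at _ _ _ E) -(Qrel_at_rmorph (Qlift rQ) (fun A => f (vgen k A))).
  by rewrite -(Qrel_at_rmorph f (@vgen k n)) vR // raddf0 raddf0.
(* By assumption $f(w)$ has filtration degree at most $|A| - 1$. So has $w$, and its coefficient $a$
   at $v_A$ vanishes. *)
pose w := a *: vgen k A + b *: vgen k B.
have w1 : Qgrade 1 w by apply: vspanD; apply/vspanZ/Qgrade_vgen.
have An : (#|A|.-1 < #|A|)%N by rewrite prednK // card_gt0.
have : vcoef A w = 0.
  apply/(vcoef_Qfilt An)/(Qaut_filtV (f := f)); apply: Qfilt_coef; first exact: Qaut_grade.
  have -> : f w = a *: f (vgen k A) + b *: f (vgen k B) by rewrite linearP linearZ.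
  by move=> C; rewrite prednK ?card_gt0 // vcoef_comb => /H.
rewrite vcoef_comb !vcoef_vgen A0 eqxx mulr1 [B == A]eq_sym (negPf AB).
by rewrite andbF mulr0 addr0.
Qed.
End Coordinates.

(** * The automorphisms coming from $k^* \times S_n$ *)

Section Standard.
Variables (k : fieldType) (n : nat).
Implicit Types (A B C : {set 'I_n}) (a : k) (s : 'S_n).

Lemma Qrel_atZ (S : algType k) a (h : {set 'I_n} -> S) A i j :
  Qrel_at (fun A => a *: h A) A i j = a ^+ 2 *: Qrel_at h A i j.
Proof.
rewrite /Qrel_at -!scalerBr !exprZn -!scalerAl -!scalerAr !scalerA -expr2.
by rewrite -scalerBr -!scalerDr.
Qed.

Lemma Qrel_at_perm (S : nzRingType) s (h : {set 'I_n} -> S) A i j :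
  Qrel_at (fun A => h (s @: A)) A i j = Qrel_at h (s @: A) (s i) (s j).
Proof. by rewrite /Qrel_at !imset_perm_setD1. Qed.

(** The relations are homogeneous of degree 2 and permuted by $S_n$. *)
Lemma Qrep_standard a s : Qrep (fun A => a *: vgen k (s @: A)).
Proof.
have [v0 vR] := Qrep_vgen k n; split=> [|A i j iA jA ij].
  by rewrite imset0 v0 scaler0.
rewrite Qrel_atZ Qrel_at_perm vR ?scaler0 ?mem_imset ?(inj_eq perm_inj) //;
  exact: perm_inj.
Qed.

Definition standard a s : {lrmorphism Qalg k n -> Qalg k n} := Qlift (Qrep_standard a s).

Lemma standard_vgen a s A : standard a s (vgen k A) = a *: vgen k (s @: A).
Proof. exact: Qlift_vgen. Qed.

Lemma vcoef_standard a s A B : A != set0 ->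
  vcoef B (standard a s (vgen k A)) = a * (s @: A == B)%:R.
Proof.
move=> A0; rewrite standard_vgen linearZ /= vcoef_vgen -card_gt0.
by rewrite card_imset ?card_gt0 ?A0 //; apply: perm_inj.
Qed.

Lemma standardZ a s c u : standard a s (c *: u) = c *: standard a s u.
Proof. exact: linearZ. Qed.

Lemma standardM a s u v : standard a s (u * v) = standard a s u * standard a s v.
Proof. exact: rmorphM. Qed.

Lemma standard_comp a b s t : standard b t \o standard a s =1 standard (a * b) (s * t)%g.
Proof.
have e A : t @: (s @: A) = (s * t)%g @: A.
  by rewrite -imset_comp; apply: eq_imset => x; rewrite permM.
have E A : standard b t (standard a s (vgen k A)) = (a * b) *: vgen k (t @: (s @: A)).
  rewrite (standard_vgen a).
  rewrite standardZ.
  rewrite (standard_vgen b).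
  exact: scalerA.
apply: eq_on_vgen => A.
apply: etrans (E A) _.
by rewrite e (standard_vgen (a * b)).
Qed.

Lemma standard1 : standard 1 1%g =1 id.
Proof.
apply: (eq_on_vgen (g := idfun)) => A; rewrite standard_vgen scale1r /=.
by rewrite (eq_imset (g := id)) ?imset_id // => x; rewrite perm1.
Qed.

Lemma standardK a s : a != 0 -> cancel (standard a s) (standard a^-1 s^-1%g).
Proof.
by move=> a0 u; rewrite [LHS]standard_comp mulfV // mulgV standard1.
Qed.

Lemma perm_Qgen_proof s (g : Qgen n) : s @: val g != set0.
Proof. by rewrite -card_gt0 card_imset ?card_gt0 ?(valP g) //; apply: perm_inj. Qed.

Definition perm_Qgen s (g : Qgen n) : Qgen n := Sub (s @: val g) (perm_Qgen_proof s g).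

Lemma mul_scale (S : algType k) (a b : k) (x y : S) : (a *: x) * (b *: y) = (a * b) *: (x * y).
Proof. by rewrite -scalerAl -scalerAr scalerA. Qed.

Lemma standard_vword a s w :
  standard a s (vword k w) = a ^+ size w *: vword k (map (perm_Qgen s) w).
Proof.
elim: w => [|g w IH]; first by rewrite /vword !big_nil rmorph1 scale1r.
have -> : map (perm_Qgen s) (g :: w) = perm_Qgen s g :: map (perm_Qgen s) w by [].
rewrite (vword_cons k g) (vword_cons k (perm_Qgen s g)) standardM IH (standard_vgen a s (val g)).
rewrite [size _]/= exprS; exact: mul_scale.
Qed.

Lemma standard_vspan a s (P : seq (Qgen n) -> Prop) u :
  (forall w, P w -> P (map (perm_Qgen s) w)) -> vspan P u -> vspan P (standard a s u).
Proof.
move=> Ps [r [Pr ->]]; rewrite linear_sum; apply: vspan_sum => t /Pr Pt.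
by rewrite linearZ /= standard_vword; do 2 apply: vspanZ; apply/vspan_word/Ps.
Qed.

(** Stability of [P] is asked for every permutation because the reverse inclusion uses $s^{-1}$. *)
Lemma standard_image a s (P : seq (Qgen n) -> Prop) : a != 0 ->
  (forall s w, P w -> P (map (perm_Qgen s) w)) ->
  (standard a s @` vspan P = vspan P)%classic.
Proof.
move=> a0 Ps; apply/seteqP; split=> [_ [u Pu <-]|u Pu].
  exact/standard_vspan/Pu/Ps.
exists (standard a^-1 s^-1%g u); first exact/standard_vspan/Pu/Ps.
by have := standardK s^-1%g (invr_neq0 a0) u; rewrite invrK invgK.
Qed.

Lemma is_Qaut_standard a s : a != 0 -> is_Qaut (standard a s).
Proof.
move=> a0; split.
- by move=> c u v; rewrite linearP.
- by split=> [|u v]; rewrite ?rmorph1 ?rmorphM.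
- exists (standard a^-1 s^-1%g); first exact: standardK.
  by have := standardK s^-1%g (invr_neq0 a0); rewrite invrK invgK.
- by move=> d; apply: standard_image => // t w; rewrite size_map.
- move=> d; apply: standard_image => // t w wd; rewrite big_map.
  apply: leq_trans wd; apply: eq_leq; apply: eq_bigr => g _.
  exact/card_imset/perm_inj.
Qed.

Definition Qstandard (x : kstar k * 'S_n) : Qaut k n :=
  MkQaut (is_Qaut_standard x.2 (valP x.1)).

(** Permutations and elements of [Qaut] both compose from left to right, so the order of factors is
    kept. *)
Lemma Qstandard_morphism : {morph Qstandard : x y / (x * y)%g}.
Proof. by move=> x y; apply: Qaut_ext => u; rewrite -[LHS]standard_comp. Qed.

HB.instance Definition _ :=
  isMultiplicative.Build (kstar k * 'S_n)%type (Qaut k n) Qstandard Qstandard_morphism.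
End Standard.

(** * The isomorphism with $k^* \times S_n$ *)

Unset Implicit Arguments.

Theorem theorem4p6 (k : fieldType) (n : nat) (hn : (3 <= n)%N) :
  exists Phi : {multiplicative (kstar k * 'S_n)%type -> Qaut k n},
    bijective Phi /\
    forall (alpha : kstar k) (tau : 'S_n) (A : {set 'I_n}), A != set0 ->
      Phi (alpha, tau) (vgen k A) = val alpha *: vgen k (tau @: A).
Proof.
exists (@Qstandard k n); split=> [|a s A _]; last exact: standard_vgen.
(* Surjectivity, by rigidity and comparison on generators; [cid] turns existence into a witness from
   which the inverse map is built. *)
have surj (f : Qaut k n) : {x | Qstandard x = f}.
  apply: cid.
  have [s [c [c0 Hc]]] := filtered_pull_rigid hn (filtered_pull_Qaut f).
  exists (exist _ c c0 : kstar k, s); apply: Qaut_ext.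
  apply: (eq_on_vgen (f := standard c s) (g := f)) => A.
  have [->|A0] := eqVneq A set0; first by rewrite vgen0 !raddf0.
  apply: etrans (standard_vgen c s A) _; apply: esym; apply: etrans (Qaut_vgen f A) _.
  rewrite (bigD1 (s @: A)) //= Hc // eqxx mulr1n big1 ?addr0 // => B BsA.
  by rewrite Hc // eq_sym (negPf BsA) mulr0n scale0r.
exists (fun f => sval (surj f)) => [[a s]|f]; last exact: svalP (surj f).
case: (surj _) => [[b t] /= E].
(* Injectivity: equal automorphisms have equal coefficients on the generators of singletons. *)
have H i X : val b * (t @: [set i] == X)%:R = val a * (s @: [set i] == X)%:R.
  have i0 : [set i] != set0 by rewrite -card_gt0 cards1.
  apply: etrans (esym (vcoef_standard (val b) t X i0)) _.
  apply: etrans _ (vcoef_standard (val a) s X i0).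
  exact: (congr1 (fun f : Qaut k n => vcoef X (f (vgen k [set i]))) E).
(* If $t(i) \ne s(i)$, the coefficient at $\{t(i)\}$ would give $b = 0$. *)
have tsi i : t i = s i.
  apply: set1_inj; apply/eqP; rewrite -!imset_set1 eq_sym; apply/negPn/negP => /negPf e.
  have := H i (t @: [set i]); rewrite eqxx e mulr1 mulr0 => /eqP.
  by rewrite (negPf (valP b)).
have i0 : 'I_n := Ordinal (ltnW (ltnW hn)).
congr pair; last exact/permP.
apply: val_inj; have := H i0 (s @: [set i0]).
by rewrite !imset_set1 tsi eqxx !mulr1.
Qed.
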